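(* Suppose $f:(0,1)\to(0,1)$ is a homeomorphism of the open interval satisfying $f(x)>x$ for all $x\in(0,1)$. Then for any positive integer $N$ there exists a totally bounded metric $d_N$ on $(0,1)$ (inducing the usual topology) such that $$h_{BD}(f,(0,1),d_N)=h_{BD}(f^{-1},(0,1),d_N)=\log N,$$ $$h_{Bc}(f,(0,1),d_N)=\log N,$$ and $$h_{Bc}(f^{-1},(0,1),d_N)=0.$$
   Context: Let $(X,d)$ be a totally bounded metric space and $g:X\to X$ continuous. For $n\ge1$ put $d^g_n(x,x')=\max_{0\le i<n}d(g^i(x),g^i(x'))$. A set $S$ is $\varepsilon$-separated with respect to a metric $\delta$ if $\delta(s,s')\ge\varepsilon$ for all distinct $s,s'\in S$; for $K\subset X$, $\operatorname{maxsep}[K,\delta,\varepsilon]$ is the maximal cardinality of a subset $S\subset K$ which is $\varepsilon$-separated with respect to $\delta$ (finite for $\delta=d^g_n$). The Bowen-Dinaburg entropy of $g$ on a subset $K\subset X$ (not assumed invariant) is $h_{BD}(g,K,d)=\lim_{\varepsilon\to0}\limsup_{n\to\infty}\frac1n\log\operatorname{maxsep}[K,d^g_n,\varepsilon]$. The Bowen compacta entropy is $h_{Bc}(g,X,d)=\sup\{h_{BD}(g,K,d):K\subset X\text{ compact}\}$. *)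

(* Defs.v *)
From HB Require Import structures.
From mathcomp Require Import all_boot all_order all_algebra.
From mathcomp Require Import all_classical all_reals all_analysis.

Set Implicit Arguments.
Unset Strict Implicit.
Unset Printing Implicit Defensive.

Import Order.TTheory GRing.Theory Num.Theory.
Import numFieldNormedType.Exports.

Local Open Scope classical_set_scope.
Local Open Scope ring_scope.

(* Nonnegativity of [d] follows from these axioms. *)
Record is_metric (R : realType) (T : Type) (d : T -> T -> R) : Prop :=
  IsMetric {
    is_metric_refl : forall x, d x x = 0;
    is_metric_eq : forall x y, d x y = 0 -> x = y;
    is_metric_sym : forall x y, d x y = d y x;
    is_metric_triangle : forall y x z, d x z <= d x y + d y z }.

(* A copy of [T], carrying the distance [d] and the topology induced by [d]
   instead of any topology that [T] may already have. *)
Definition metric_space (R : realType) (T : choiceType) (d : T -> T -> R)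
  (dm : is_metric d) : Type := T.

HB.instance Definition _ (R : realType) (T : choiceType) (d : T -> T -> R)
  (dm : is_metric d) := Choice.on (metric_space dm).

HB.instance Definition _ (R : realType) (T : choiceType) (d : T -> T -> R)
    (dm : is_metric d) :=
  @isMetric.Build R (metric_space dm) d
    (is_metric_refl dm) (is_metric_eq dm)
    (is_metric_sym dm) (is_metric_triangle dm).

Section entropy.
Variables (R : realType) (X : metricType R).
Implicit Types (g : X -> X) (K S : set X) (delta : X -> X -> R) (eps : R).

Definition totally_bounded : Prop :=
  forall eps, 0 < eps ->
    exists2 F : set X, finite_set F & [set: X] = \bigcup_(x in F) ball x eps.

(* The default value 0 of the maximum is harmless as distances are
   nonnegative; it only matters for n = 0. *)
Definition dyn_dist g (n : nat) (x y : X) : R :=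
  \big[Num.max/0]_(i < n) mdist (iter i g x) (iter i g y).

Definition separated delta eps S : Prop :=
  forall s t, S s -> S t -> s <> t -> eps <= delta s t.

(* [counting] is the cardinality, with value +oo on infinite sets. *)
Definition maxsep K delta eps : \bar R :=
  ereal_sup [set counting S | S in [set S | S `<=` K /\
                                              separated delta eps S]].

(* [lne] is the extended logarithm: for K = set0 the entropy is -oo, which
   does not affect the supremum defining [hBc] on a nonempty space. *)
Definition hBD g K : \bar R :=
  lim ((fun eps => limn_esup (fun n : nat =>
          (n%:R^-1)%:E * lne (maxsep K (dyn_dist g n) eps))%E) @ 0^'+).

Definition hBc g : \bar R := ereal_sup [set hBD g K | K in [set K | compact K]].

End entropy.

Arguments totally_bounded {R} X.
Arguments hBD {R} X g K.
Arguments hBc {R} X g.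

Notation open_unit_interval R := (set_type (`]0, 1[%classic : set R)).

(* Main.v *)
Require Import Defs.
From HB Require Import structures.
From mathcomp Require Import all_boot all_order all_algebra.
From mathcomp Require Import all_classical all_reals all_analysis.
From mathcomp Require Import ring lra zify.
Import Order.TTheory GRing.Theory Num.Theory.
Import numFieldNormedType.Exports.
Local Open Scope classical_set_scope.
Local Open Scope ring_scope.

Set Implicit Arguments.
Unset Strict Implicit.
Unset Printing Implicit Defensive.

(** The metric makes the right end of the interval wind around a circle on
    which f acts as multiplication by N.  Fix a point a.  [exists_height]
    builds a continuous height Phi >= 0 that vanishes left of a, increases
    linearly from 0 to 1 on the fundamental domain from a to f a, and
    satisfies Phi (f x) = 1 + N * Phi x for x >= a.  The metric is
      hdist x y = |x - y| + (distance from Phi x - Phi y to the integers),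
    the metric of the graph of Phi mod 1.  It induces the usual topology
    because Phi is continuous.

    Upper bounds come from codes: if points with the same code stay
    eps-close for n steps, then there are at most as many eps-separated
    points as codes ([maxsep_le_codes]).  The summand |x - y| costs only
    polynomially many codes in n, because orbits are monotone
    ([monotone_code]).  For the heights there are two regimes.
    - Real heights are contracted by the inverse map:
      |Phi x - Phi y| <= |Phi (f x) - Phi (f y)| for all x and y
      ([Phi_contract]).  So for x <= a the number Phi (f^n x), which is at
      most n * N^n, determines up to eps the heights of the first n iterates
      of x.
    - For x >= a differences of heights are multiplied by N at each step, so
      that a grid of mesh eps / N^n for Phi x mod 1 suffices.
    Both regimes need about N^n codes up to a factor polynomial in n, hence
    the bound ln N for f.  An orbit segment of f^-1 is a reversed orbit
    segment of f, so ln N bounds the entropy of f^-1 on the whole interval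
    as well.  On a compact set, Phi is bounded, and contraction by f^-1
    leaves boundedly many codes for the heights: the entropy of f^-1 is 0.

    Lower bound: the N^n points of the fundamental domain with heights
    q / N^n are (1 / N)-separated within n steps ([orbits_separate]); pushing
    them forward by f^(n-1) gives as many points that f^-1 separates.  These
    images leave every compact set as n grows, which is why the compacta
    entropy of f^-1 does not see them. *)

(** * Counting separated points, and exponential growth rates *)

Section separated_counts.
Variables (R : realType) (X : metricType R).
Implicit Types (K S : set X) (delta : X -> X -> R) (eps : R).

(** A code whose fibres have diameter less than eps is injective on every
    eps-separated set. *)
Lemma maxsep_le_card (C : finType) (code : X -> C) K delta eps :
  (forall x y, K x -> K y -> code x = code y -> delta x y < eps) ->
  (maxsep K delta eps <= (#|C|%:R : R)%:E)%E.
Proof.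
move=> codeP; apply: ge_ereal_sup => _ [S [SK sepS] <-].
pose h x : nat := enum_rank (code x).
have hI : {in S &, injective h}.
  move=> x y /set_mem Sx /set_mem Sy /ord_inj/enum_rank_inj cxy.
  have [//|/eqP nxy] := eqVneq x y.
  by have := sepS x y Sx Sy nxy; rewrite leNgt (codeP _ _ (SK _ Sx) (SK _ Sy)).
have leS : (S #<= `I_#|C|)%card.
  have /card_eqPle[_ leSh] := inj_card_eq hI.
  apply: card_le_trans leSh _; apply: subset_card_le => _ [x _ <-] /=.
  exact: ltn_ord.
rewrite /counting asboolT; last by apply/finite_set_leP; exists #|C|.
by rewrite lee_fin ler_nat; exact: geq_card_fset_set.
Qed.

Lemma le_maxsep (m : nat) (h : nat -> X) K delta eps :
  (0 < eps) -> (forall x, delta x x = 0) ->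
  (forall i, (i < m)%N -> K (h i)) ->
  (forall i j, (i < m)%N -> (j < m)%N -> i <> j -> eps <= delta (h i) (h j)) ->
  ((m%:R : R)%:E <= maxsep K delta eps)%E.
Proof.
move=> eps0 dxx hK hsep.
have hI : {in `I_m &, injective h}.
  move=> i j /set_mem /= im /set_mem /= jm hij.
  have [//|/eqP nij] := eqVneq i j.
  by have := hsep _ _ im jm nij; rewrite hij dxx leNgt eps0.
have /card_eqPle[leIm leI] := inj_card_eq hI.
have fin : finite_set (h @` `I_m) by apply/finite_set_leP; exists m.
apply: (@le_trans _ _ (counting (h @` `I_m))).
  by rewrite /counting asboolT// lee_fin ler_nat leq_card_fset_set.
apply: ereal_sup_ubound; exists (h @` `I_m) => //; split.
  by move=> _ [i im <-]; exact: hK.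
by move=> _ _ [i im <-] [j jm <-] hij; apply: hsep => // ij; apply: hij; rewrite ij.
Qed.

Lemma maxsep_le_subset K K' delta eps : K `<=` K' ->
  (maxsep K delta eps <= maxsep K' delta eps)%E.
Proof.
move=> KK'; apply: ereal_sup_le => _ [S [SK sepS] <-].
by exists S => //; split=> //; exact: subset_trans KK'.
Qed.

Lemma maxsep_antitone K delta eps eps' : eps <= eps' ->
  (maxsep K delta eps' <= maxsep K delta eps)%E.
Proof.
move=> le_eps; apply: ereal_sup_le => _ [S [SK sepS] <-].
exists S => //; split=> // s t Ss St st.
exact: le_trans le_eps (sepS s t Ss St st).
Qed.

Lemma le_lne (x y : \bar R) : (x <= y)%E -> (lne x <= lne y)%E.
Proof.
move=> xy; have [x0|x0] := leP x 0%E; first by rewrite le0_lneNy// leNye.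
by rewrite lee_lne// in_itv/= leey andbT ?(le_trans (ltW x0) xy)// ltW.
Qed.
End separated_counts.

Section rates.
Variables (R : realType).
(** The error term A / n lets A depend on the slack delta; this is what the
    comparison of ln n with delta * n in [hBD_le_ln] provides. *)
Lemma limn_esup_le (u : (\bar R)^nat) (c : R) :
  (forall delta, 0 < delta -> exists A : R, forall n, (0 < n)%N ->
     (u n <= (c + delta + A / n%:R)%:E)%E) ->
  (limn_esup u <= c%:E)%E.
Proof.
move=> uP; apply/lee_addgt0Pr => e e0.
have [A uA] := uP _ (divr_gt0 e0 (ltr0n R 2)).
have [k kA] : exists k, `|A| / (e / 2) < k%:R :> R.
  by exists (Num.bound (`|A| / (e / 2))); rewrite archi_boundP// divr_ge0// divr_ge0// ltW.
apply: (@le_trans _ _ (ereal_sup (u @` [set n | (k.+1 <= n)%N]))).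
  by apply: ereal_inf_lbound; exists [set n | (k.+1 <= n)%N] => //; exists k.+1.
apply: ge_ereal_sup => _ [n /= kn <-].
have n0 : (0 < n)%N by apply: leq_trans kn.
apply: le_trans (uA n n0) _; rewrite -EFinD lee_fin -addrA lerD2l.
rewrite [leRHS]splitr lerD2l ler_pdivrMr ?ltr0n//.
apply: le_trans (ler_norm _) _; rewrite mulrC -ler_pdivrMr ?divr_gt0//.
apply: le_trans (ltW kA) _; rewrite ler_nat; exact: ltnW.
Qed.

Lemma le_limn_esup (u : (\bar R)^nat) (c : \bar R) :
  (forall n, (0 < n)%N -> (c <= u n)%E) -> (c <= limn_esup u)%E.
Proof.
move=> cu; apply: le_ereal_inf_tmp => _ [A [k _ kA] <-].
apply: le_trans (cu k.+1 isT) _; apply: ereal_sup_ubound.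
by exists k.+1 => //; apply: kA => /=.
Qed.

Lemma limn_esup_homo (u v : (\bar R)^nat) :
  (forall n, (u n <= v n)%E) -> (limn_esup u <= limn_esup v)%E.
Proof.
move=> uv; apply: le_ereal_inf_tmp => _ [A oA <-].
apply: (@le_trans _ _ (ereal_sup (u @` A))).
  by apply: ereal_inf_lbound; exists A.
apply: ge_ereal_sup => _ [n An <-]; apply: le_trans (uv n) _.
by apply: ereal_sup_ubound; exists n.
Qed.

End rates.

Section entropy_bounds.
Variables (R : realType) (X : metricType R).
Implicit Types (g : X -> X) (K : set X) (N : nat).

Local Notation rate g K eps :=
  (limn_esup (fun n : nat =>
     ((n%:R^-1 : R)%:E * lne (maxsep K (dyn_dist g n) eps))%E)).

(** Since [hBD] is a total limit operator, bounds on its value rest on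
    convergence, which follows from monotonicity in eps. *)
Lemma hBD_is_cvg g K : cvg ((fun eps => rate g K eps) @ (0 : R)^'+).
Proof.
apply: nonincreasing_at_right_is_cvge; apply: nearW => e x y _ _ xy.
apply: limn_esup_homo => n; apply: lee_wpmul2l; first by rewrite lee_fin invr_ge0.
by apply: le_lne; apply: maxsep_antitone.
Qed.

Lemma hBD_subset g K K' : K `<=` K' -> (hBD X g K <= hBD X g K')%E.
Proof.
move=> KK'; apply: lee_lim; [exact: hBD_is_cvg|exact: hBD_is_cvg|].
apply: nearW => e; apply: limn_esup_homo => n; apply: lee_wpmul2l.
  by rewrite lee_fin invr_ge0.
by apply: le_lne; apply: maxsep_le_subset.
Qed.

(** The polynomial factor is lost in the exponential growth rate. *)
Lemma hBD_le_ln g K N : (0 < N)%N ->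
  (forall eps, 0 < eps -> exists (A : R) (m : nat), 0 < A /\ forall n,
     (maxsep K (dyn_dist g n) eps <= (A * n.+1%:R ^+ m * N%:R ^+ n)%:E)%E) ->
  (hBD X g K <= (ln N%:R)%:E)%E.
Proof.
move=> N0 growth; apply: lime_le; first exact: hBD_is_cvg.
near=> eps; have eps0 : 0 < eps by near: eps; exact: nbhs_right_gt.
have [A [m [A0 bnd]]] := growth _ eps0.
apply: limn_esup_le => delta delta0.
have [s s0 sm] : exists2 s : R, 0 < s & m%:R * s <= delta.
  exists (delta / m.+1%:R); first by rewrite divr_gt0.
  by rewrite mulrA ler_pdivrMr// mulrC ler_pM2l// ler_nat.
exists (ln A + delta - m%:R * ln s) => n n0.
have nR : 0 < n%:R :> R by rewrite ltr0n.
apply: (@le_trans _ _ ((n%:R^-1 : R)%:E * (ln (A * n.+1%:R ^+ m * N%:R ^+ n))%:E)%E).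
  apply: lee_wpmul2l; first by rewrite lee_fin invr_ge0.
  apply: (le_trans (le_lne (bnd n))); rewrite lne_EFin//.
  by rewrite !mulr_gt0// exprn_gt0// ltr0n.
rewrite -EFinM lee_fin mulrC ler_pdivrMr//.
rewrite !lnM ?posrE ?mulr_gt0// ?exprn_gt0 ?ltr0n//.
rewrite !lnXn ?ltr0n// mulrDl divfK ?gt_eqF// -![ln _ *+ _]mulr_natl.
(* ln y < y at y = s * n.+1 bounds the logarithm by a line of slope s. *)
have lnn : ln n.+1%:R <= s * n.+1%:R - ln s.
  rewrite lerBrDl -lnM ?posrE// ?ltr0n//.
  by apply/ltW/ln_sublinear; rewrite mulr_gt0.
have := ler_wpM2l (ler0n R m) lnn.
have := ler_wpM2r (ler0n R n.+1) sm.
have nS : n.+1%:R = n%:R + 1 :> R by rewrite natr1.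
move: lnn; set L := ln n.+1%:R; rewrite nS => lnn.
lra.
Unshelve. all: by end_near. Qed.

Lemma ln_le_hBD g K N e0 : (0 < N)%N -> 0 < e0 ->
  (forall eps n, 0 < eps -> eps <= e0 ->
     ((N%:R ^+ n)%:E <= maxsep K (dyn_dist g n) eps)%E) ->
  ((ln N%:R)%:E <= hBD X g K)%E.
Proof.
move=> N0 e00 growth; apply: lime_ge; first exact: hBD_is_cvg.
near=> eps; apply: le_limn_esup => n n0.
have nR : 0 < n%:R :> R by rewrite ltr0n.
apply: (@le_trans _ _ ((n%:R^-1 : R)%:E * (ln (N%:R ^+ n))%:E)%E).
  rewrite -EFinM lee_fin lnXn ?ltr0n// -[ln _ *+ _]mulr_natr mulrC mulfK// gt_eqF//.
apply: lee_wpmul2l; first by rewrite lee_fin invr_ge0.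
rewrite -lne_EFin ?exprn_gt0 ?ltr0n//; apply: le_lne; apply: growth.
  by near: eps; exact: nbhs_right_gt.
by near: eps; exact: nbhs_right_le.
Unshelve. all: by end_near. Qed.

End entropy_bounds.

(** * Distance to the nearest integer *)

Section nearest_integer.
Variable R : realType.
Implicit Types (s t : R) (m : int).

Definition dist_int t : R :=
  Num.min (t - (Num.floor t)%:~R) ((Num.floor t)%:~R + 1 - t).

Lemma dist_int_le t m : dist_int t <= `|t - m%:~R|.
Proof.
have /andP[fl_le fl_gt] := floor_itv t; rewrite intrD in fl_gt.
have [mt|mt] := leP (m%:~R : R) t.
  rewrite ge_min ger0_norm ?subr_ge0// lerD2l lerN2.
  by apply/orP; left; rewrite ler_int floor_ge_int.
rewrite ge_min ltr0_norm ?subr_lt0// opprB lerD2r.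
apply/orP; right; rewrite -[1]/(1%:~R) -intrD ler_int lezD1.
by rewrite -(ltr_int R); apply: le_lt_trans mt.
Qed.

Lemma dist_int_attained t : exists m, dist_int t = `|t - m%:~R|.
Proof.
have /andP[fl_le fl_gt] := floor_itv t; rewrite intrD in fl_gt.
rewrite /dist_int; case: leP => _; [exists (Num.floor t)|exists (Num.floor t + 1)].
  by rewrite ger0_norm// subr_ge0.
by rewrite ltr0_norm ?subr_lt0 intrD ?opprB.
Qed.

Lemma dist_int_ge0 t : 0 <= dist_int t.
Proof. by have [m ->] := dist_int_attained t. Qed.

Lemma dist_int_le_norm t : dist_int t <= `|t|.
Proof. by have := dist_int_le t 0; rewrite subr0. Qed.

Lemma dist_int0 : dist_int 0 = 0.
Proof.
by apply/eqP; rewrite eq_le dist_int_ge0 andbT (le_trans (dist_int_le_norm 0))// normr0.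
Qed.

Lemma dist_intN t : dist_int (- t) = dist_int t.
Proof.
have h s : dist_int (- s) <= dist_int s.
  have [m ->] := dist_int_attained s; apply: le_trans (dist_int_le _ (- m)) _.
  have -> : - s - (- m)%:~R = - (s - m%:~R) :> R by rewrite mulrNz; ring.
  by rewrite normrN.
by apply/eqP; rewrite eq_le h -{1}(opprK t) h.
Qed.

Lemma dist_intD s t : dist_int (s + t) <= dist_int s + dist_int t.
Proof.
have [m ->] := dist_int_attained s; have [k ->] := dist_int_attained t.
apply: le_trans (dist_int_le _ (m + k)) _.
by rewrite intrD opprD addrACA ler_normD.
Qed.

Lemma dist_intMn t k : dist_int (k%:R * t) <= k%:R * dist_int t.
Proof.
have [m ->] := dist_int_attained t; apply: le_trans (dist_int_le _ (k%:Z * m)) _.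
by rewrite intrM -pmulrn -mulrBr normrM ger0_norm.
Qed.

(** Writing the distance with numerator q - m * k over k, the numerator is a
    nonzero integer. *)
Lemma dist_int_frac (q : int) (k : nat) : (0 < k)%N -> ~~ (k %| q)%Z ->
  k%:R^-1 <= dist_int (q%:~R / k%:R).
Proof.
move=> k0 kq; have kR : 0 < k%:R :> R by rewrite ltr0n.
have [m ->] := dist_int_attained (q%:~R / k%:R).
have -> : q%:~R / k%:R - m%:~R = (q - m * k%:Z)%:~R / k%:R :> R.
  by rewrite intrD mulrNz intrM mulrBl -pmulrn mulfK// gt_eqF.
rewrite normrM [`|_^-1|]ger0_norm ?invr_ge0//.
rewrite ler_peMl ?invr_ge0//.
rewrite -intr_norm -[1]/(1%:~R) ler_int -gtz0_ge1 normr_gt0 subr_eq0.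
by apply: contra kq => /eqP ->; exact: dvdz_mull.
Qed.

End nearest_integer.

(** * Finite codes for real quantities *)

Section finite_codes.
Variable R : realType.

Lemma grid_code (T : Type) (v : T -> R) (B eps : R) :
  0 < eps -> (forall x, 0 <= v x <= B) ->
  exists code : T -> 'I_(Num.truncn (B / eps)).+1,
    forall x y, code x = code y -> `|v x - v y| < eps.
Proof.
move=> eps0 vB.
have v0 x : 0 <= v x / eps by apply: divr_ge0 (ltW eps0); case/andP: (vB x).
have codeP x : (Num.truncn (v x / eps) < (Num.truncn (B / eps)).+1)%N.
  rewrite ltnS; apply: le_truncn; rewrite ler_pM2r ?invr_gt0//.
  by case/andP: (vB x).
exists (fun x => Ordinal (codeP x)) => x y [] eq_cell.
have -> : v x - v y = (v x / eps - v y / eps) * eps.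
  by rewrite -mulrBl divfK// gt_eqF.
rewrite normrM (gtr0_norm eps0) -[ltRHS]mul1r ltr_pM2r//.
have /andP[] := truncn_itv (v0 x); have /andP[] := truncn_itv (v0 y).
rewrite eq_cell -natr1 => *; rewrite ltr_norml; lra.
Qed.

(** For each of the m multiples of eps in the unit interval, record at how
    many of the first n times the sequence lies below it.  Monotonicity turns
    these counts into the crossing times, so they locate every term up to
    eps.  What matters is that m does not depend on n: the number of codes is
    polynomial in n. *)
Lemma monotone_code (T : Type) (u : nat -> T -> R) (eps : R) : 0 < eps ->
  (forall i x, 0 <= u i x <= 1) ->
  (forall i j x, (i <= j)%N -> u i x <= u j x) ->
  exists m : nat, forall n, exists code : T -> {ffun 'I_m -> 'I_n.+1},
    forall x y, code x = code y ->
      forall i, (i < n)%N -> `|u i x - u i y| < eps.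
Proof.
move=> eps0 u01 u_mono; pose m := Num.bound eps^-1.
have m_eps : 1 < m%:R * eps.
  by rewrite -ltr_pdivrMr// mul1r archi_boundP// invr_ge0 ltW.
exists m => n.
pose low x (l : 'I_m) := [set i : 'I_n | u i x < l%:R * eps]%SET.
have lowP x l : (#|low x l| < n.+1)%N.
  by rewrite ltnS; apply: leq_trans (max_card _) _; rewrite card_ord.
exists (fun x => [ffun l => Ordinal (lowP x l)]) => x y eq_code i ni.
have low_eq l : #|low x l| = #|low y l|.
  by have /ffunP/(_ l) := eq_code; rewrite !ffunE => -[].
(* If the terms differ by eps, the first grid level l * eps above the lower
   one separates them, and the two counts for l differ. *)
have half a b : (forall l, #|low a l| = #|low b l|) -> u i a + eps <= u i b -> False.
  move=> low_ab gap.
  have /andP[ua0 ua1] := u01 i a; have /andP[ub0 ub1] := u01 i b.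
  have /andP[t_le t_gt] := truncn_itv (divr_ge0 ua0 (ltW eps0)).
  move: t_le t_gt; set t := Num.truncn _.
  rewrite ler_pdivlMr// ltr_pdivrMr// => t_le t_gt.
  have t_lt_m : (t.+1 < m)%N.
    rewrite -(ltr_nat R) -(ltr_pM2r eps0); apply: le_lt_trans m_eps.
    rewrite -natr1 mulrDl mul1r; lra.
  pose l := Ordinal t_lt_m.
  suff /proper_card : low b l \proper low a l by rewrite low_ab ltnn.
  have ubl : l%:R * eps <= u i b by rewrite /= -natr1 mulrDl mul1r; lra.
  apply/properP; split.
    apply/fintype.subsetP => j; rewrite !inE => ujb.
    have ji : (j <= i)%N.
      rewrite leqNgt; apply/negP => /ltnW ij.
      by move: (lt_le_trans ujb ubl); rewrite ltNge u_mono.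
    exact: le_lt_trans (u_mono _ _ _ ji) t_gt.
  by exists (Ordinal ni); rewrite !inE//= -leNgt.
rewrite ltNge; apply/negP => gap.
have [uxy|uxy] := leP (u i x) (u i y).
  by apply: (half x y low_eq); move: gap; rewrite ler0_norm ?subr_le0//; lra.
apply: (half y x (fun l => esym (low_eq l))); move: gap.
by rewrite gtr0_norm ?subr_gt0//; lra.
Qed.

End finite_codes.

(** * The open unit interval *)

Section unit_interval.
Variable R : realType.
Local Notation I := (open_unit_interval R).
Implicit Types x y : I.

Lemma val_oui_gt0 x : 0 < \val x.
Proof. by case: x => r /= /set_mem /=; rewrite in_itv/= => /andP[]. Qed.

Lemma val_oui_lt1 x : \val x < 1.
Proof. by case: x => r /= /set_mem /=; rewrite in_itv/= => /andP[]. Qed.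

Lemma mem_oui (r : R) : 0 < r -> r < 1 -> r \in (`]0, 1[%classic : set R).
Proof. by move=> r0 r1; apply/mem_set; rewrite /= in_itv/= r0. Qed.

Lemma continuous_val_oui : continuous (\val : I -> R).
Proof. exact: initial_continuous. Qed.

Lemma nbhs_ouiP x (A : set I) :
  nbhs x A <-> exists2 e : R, 0 < e & forall y, `|\val x - \val y| < e -> A y.
Proof.
split=> [[B [[C oC <-] Cx CA]]|[e e0 eA]].
  have /nbhs_ballP[e e0 eC] := open_nbhs_nbhs (conj oC Cx).
  by exists e => // y xy; apply: CA; apply: eC.
have : \forall y \near x, ball (\val x) e (\val y).
  by apply: continuous_val_oui; apply: nbhsx_ballx.
by apply: filterS => y; apply: eA.
Qed.

Definition oui_half : I := SigSub (mem_oui (divr_gt0 ltr01 (ltr0n R 2)) (ltac:(lra) : 1 / 2 < 1)).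

Definition oui (r : R) : I := insubd oui_half r.

Lemma ouiK (r : R) : 0 < r -> r < 1 -> \val (oui r) = r.
Proof. by move=> r0 r1; rewrite insubdK// mem_oui. Qed.

Lemma continuous_oui (r : R) : 0 < r -> r < 1 -> {for r, continuous oui}.
Proof.
move=> r0 r1 A /nbhs_ouiP[e e0 eA].
suff : \forall s \near r, A (oui s) by [].
near=> s; apply: eA; rewrite !ouiK//.
- by near: s; exact: lt_nbhsr.
- by near: s; exact: lt_nbhsl.
Unshelve. all: by end_near. Qed.

Lemma oui_within_continuous (a b : R) : 0 < a -> b < 1 ->
  {within `[a, b], continuous oui}.
Proof.
move=> a0 b1; apply: continuous_in_subspaceT => r /set_mem /=.
rewrite in_itv/= => /andP[ar rb].
by apply: continuous_oui; [exact: lt_le_trans ar|exact: le_lt_trans b1].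
Qed.

Lemma compact_oui_itv (a b : I) : compact [set x : I | \val a <= \val x <= \val b].
Proof.
have -> : [set x : I | \val a <= \val x <= \val b] = oui @` `[\val a, \val b].
  apply/seteqP; split=> [x /= axb|_ [r /= + <-]].
    exists (\val x); first by rewrite /= in_itv.
    by apply: val_inj; rewrite ouiK// ?val_oui_gt0// val_oui_lt1.
  rewrite in_itv/= => /andP[ar rb]; rewrite ouiK ?ar//.
    exact: lt_le_trans (val_oui_gt0 a) ar.
  exact: le_lt_trans rb (val_oui_lt1 b).
apply: continuous_compact (@segment_compact _ _ _).
by apply: oui_within_continuous; [exact: val_oui_gt0|exact: val_oui_lt1].
Qed.

End unit_interval.

(** * Homeomorphisms that push every point to the right *)

Section wandering_homeomorphism.
Variable R : realType.
Local Notation I := (open_unit_interval R).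
Variables f finv : I -> I.
Hypotheses (fK : cancel f finv) (finvK : cancel finv f).
Hypotheses (f_cont : continuous f) (finv_cont : continuous finv).
Hypothesis f_gt : forall x : I, \val x < \val (f x).
Implicit Types x y : I.

(** If x < y but f x >= f y, then f passes through the value f x again to the
    right of y, because f z > z >= f x for z close to 1; this contradicts
    injectivity. *)
Lemma f_increasing x y : \val x < \val y -> \val (f x) < \val (f y).
Proof.
move=> xy; rewrite ltNge; apply/negP => fyx.
have f_inj := can_inj fK.
pose F r := \val (f (oui r)).
pose b := Num.max (\val y) (\val (f x)).
have yb : \val y <= b by rewrite le_max lexx.
have b1 : b < 1 by rewrite gt_max !val_oui_lt1.
have b0 : 0 < b := lt_le_trans (val_oui_gt0 y) yb.
have Fb : \val (f x) <= F b.
  apply: (@le_trans _ _ b); first by rewrite /b le_max lexx orbT.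
  by have := f_gt (oui b); rewrite ouiK// => /ltW.
have Fy : F (\val y) = \val (f y) by rewrite /F /oui valKd.
have F_cont : {within `[\val y, b], continuous F}.
  apply: continuous_in_subspaceT => r /set_mem /=.
  rewrite in_itv/= => /andP[yr rb].
  suff : {for r, continuous ((\val \o f) \o (@oui R))} by [].
  apply: continuous_comp.
    by apply: continuous_oui; [exact: lt_le_trans (val_oui_gt0 y) yr|exact: le_lt_trans b1].
  apply: continuous_comp; [exact: f_cont|exact: continuous_val_oui].
have [|c] := IVT (v := \val (f x)) yb F_cont.
  by rewrite ge_min le_max Fy fyx Fb orbT.
rewrite in_itv/= => /andP[yc cb].
have c0 : 0 < c := lt_le_trans (val_oui_gt0 y) yc.
have c1 : c < 1 := le_lt_trans cb b1.
move=> /val_inj/f_inj cx; move: (congr1 \val cx); rewrite ouiK// => ceq.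
by move: xy; rewrite -ceq ltNge yc.
Qed.

Lemma f_mono x y : (\val (f x) <= \val (f y)) = (\val x <= \val y).
Proof.
have [xy|yx] := leP (\val x) (\val y); last first.
  by apply/negbTE; rewrite -ltNge f_increasing.
move: xy; rewrite le_eqVlt => /predU1P[/val_inj ->|/f_increasing/ltW->//].
exact: lexx.
Qed.

Lemma finv_mono x y : (\val (finv x) <= \val (finv y)) = (\val x <= \val y).
Proof. by rewrite -f_mono !finvK. Qed.

Lemma iter_f_le i j x : (i <= j)%N -> \val (iter i f x) <= \val (iter j f x).
Proof.
move=> /subnK <-; elim: (j - i)%N => [|k IH]; first exact: lexx.
by rewrite addSn iterS (le_trans IH)// ltW.
Qed.

Lemma iter_finv_le i j x : (i <= j)%N -> \val (iter j finv x) <= \val (iter i finv x).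
Proof.
move=> /subnK <-; elim: (j - i)%N => [|k IH]; first exact: lexx.
by rewrite addSn iterS (le_trans _ IH)// -f_mono finvK ltW.
Qed.

Lemma iter_finv_mono k x y : \val x <= \val y -> \val (iter k finv x) <= \val (iter k finv y).
Proof. by move=> xy; elim: k => //= k IH; rewrite finv_mono. Qed.

(** If a backward orbit stayed above a, its infimum l would lie in the
    interval; since l < f l the orbit would get below f l, and one step later
    below l. *)
Lemma iter_finv_below (a x : I) : exists k, \val (iter k finv x) <= \val a.
Proof.
apply/not_existsP => above.
pose O := [set \val (iter k finv x) | k in [set: nat]].
have O_inf : has_inf O.
  split; first by exists (\val x); exists 0%N.
  by exists (\val a) => _ [k _ <-]; rewrite leNgt; apply/negP => /ltW; exact: above.
have a_inf : \val a <= inf O.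
  apply: lb_le_inf; first by case: O_inf.
  by move=> _ [k _ <-]; rewrite leNgt; apply/negP => /ltW; exact: above.
have inf_le k : inf O <= \val (iter k finv x).
  by apply: ge_inf; [case: O_inf|exists k].
pose l := oui (inf O).
have lE : \val l = inf O.
  apply: ouiK; first exact: lt_le_trans (val_oui_gt0 a) a_inf.
  exact: le_lt_trans (inf_le 0%N) (val_oui_lt1 x).
have [_ [k _ <-] kl] : exists2 r, O r & r < \val (f l).
  by apply: inf_lt; [case: O_inf|rewrite -lE f_gt].
have := inf_le k.+1; rewrite -lE -f_mono finvK leNgt.
by rewrite kl.
Qed.

(** The height is the sum over k >= 0 of N^k * ramp (f^-k x), where the ramp
    rises linearly from 0 to 1 between a and f a and is constant outside.
    The sum is locally finite because backward orbits end up below a.  Then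
    Phi (f x) = ramp (f x) + N * Phi x, which gives both the recursion above
    a and the values on the fundamental domain. *)
Lemma exists_height (a : I) (N : nat) : exists Phi : I -> R,
  [/\ continuous Phi,
      forall x, 0 <= Phi x,
      forall x, \val x <= \val a -> Phi x = 0,
      forall x, \val a <= \val x -> Phi (f x) = 1 + N%:R * Phi x &
      forall x, \val a <= \val x <= \val (f a) ->
        Phi x = (\val x - \val a) / (\val (f a) - \val a)].
Proof.
have len_gt0 : 0 < \val (f a) - \val a by rewrite subr_gt0.
pose ramp x : R := Num.min 1 (Num.max 0 ((\val x - \val a) / (\val (f a) - \val a))).
have ramp_ge0 x : 0 <= ramp x by rewrite le_min ler01 le_max lexx.
have ramp0 x : \val x <= \val a -> ramp x = 0.
  move=> xa; rewrite /ramp (max_idPl _) ?min_r//.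
  by rewrite pmulr_lle0 ?invr_gt0// subr_le0.
have ramp1 x : \val (f a) <= \val x -> ramp x = 1.
  move=> fax; rewrite /ramp min_l// le_max; apply/orP; right.
  by rewrite ler_pdivlMr// mul1r lerD2r.
have rampE x : \val a <= \val x <= \val (f a) ->
    ramp x = (\val x - \val a) / (\val (f a) - \val a).
  move=> /andP[ax xfa]; rewrite /ramp max_r ?divr_ge0 ?subr_ge0//; last exact: ltW.
  by rewrite min_r// ler_pdivrMr// mul1r lerD2r.
have ramp_cont : continuous ramp.
  move=> x; apply: (@continuous_min R I (cst 1)); first exact: cst_continuous.
  apply: (@continuous_max R I (cst 0)); first exact: cst_continuous.
  apply: continuousM; last exact: cst_continuous.
  apply: continuousB; last exact: cst_continuous.
  exact: continuous_val_oui.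
(* kap x bounds the number of nonzero terms of the sum at all y <= x. *)
have [kap kapP] := choice (iter_finv_below a).
have below k x y : \val y <= \val x -> (kap x <= k)%N -> \val (iter k finv y) <= \val a.
  move=> yx xk; apply: le_trans (kapP x).
  by apply: le_trans (iter_finv_mono _ yx) _; exact: iter_finv_le.
pose S k x := \sum_(i < k) N%:R ^+ i * ramp (iter i finv x).
have S_stable k x y : \val y <= \val x -> (kap x <= k)%N -> S k y = S (kap x) y.
  move=> yx /subnK <-; elim: (k - kap x)%N => [//|j IH].
  by rewrite addSn /S big_ord_recr/= -/(S _ _) IH ramp0 ?mulr0 ?addr0// (below _ _ _ yx) ?leq_addl.
pose Phi x := S (kap x) x.
have PhiE k x y : \val y <= \val x -> (kap x <= k)%N -> Phi y = S k y.
  move=> yx xk; rewrite /Phi -(S_stable (maxn k (kap y)) y y)// ?leq_maxr//.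
  by rewrite (S_stable _ x)// ?(leq_trans xk) ?leq_maxl// -(S_stable k).
have S_cont k : continuous (S k).
  have iter_cont i : continuous (iter i finv).
    elim: i => [|i IH] x /=; first exact: cvg_id.
    by apply: continuous_comp; [exact: IH|exact: finv_cont].
  elim: k => [|k IH] x.
    have -> : S 0%N = cst 0 by apply/funext => y; rewrite /S big_ord0.
    exact: cst_continuous.
  have -> : S k.+1 = S k \+ (cst (N%:R ^+ k) \* (ramp \o iter k finv)).
    by apply/funext => y; rewrite /S big_ord_recr.
  apply: continuousD; first exact: IH.
  apply: continuousM; first exact: cst_continuous.
  by apply: continuous_comp; [exact: iter_cont|exact: ramp_cont].
have Phi0 x : \val x <= \val a -> Phi x = 0.
  move=> xa; rewrite /Phi /S big1// => i _; rewrite ramp0 ?mulr0//.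
  exact: le_trans (iter_finv_le x (leq0n i)) xa.
have Phi_step x : Phi (f x) = ramp (f x) + N%:R * Phi x.
  pose k := maxn (kap x) (kap (f x)).
  rewrite (PhiE k.+1 (f x))//; last by rewrite (leq_trans (leq_maxr (kap x) _)).
  rewrite (PhiE k x)//; last by rewrite leq_maxl.
  rewrite /S big_ord_recl/= expr0 mul1r mulr_sumr; congr (_ + _).
  by apply: eq_bigr => i _; rewrite /bump !add1n add0n -iterS iterSr fK exprS mulrA.
exists Phi; split=> //.
(* f x serves as a point to the right of x: kap (f x) terms suffice on a
   neighbourhood of x. *)
- move=> x; have near_x : \forall y \near x, Phi y = S (kap (f x)) y.
    apply/nbhs_ouiP; exists (\val (f x) - \val x); first by rewrite subr_gt0.
    move=> y xy; apply: (PhiE _ (f x)) => //.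
    by move: xy; rewrite distrC => /ltr_normlW; rewrite ltrD2r => /ltW.
  have := S_cont (kap (f x)) x; rewrite /continuous_at -(nbhs_singleton near_x).
  apply: cvg_trans; apply: (@near_eq_cvg _ _ (nbhs x)).
  by apply: filterS near_x => y ->.
- by move=> x; apply: sumr_ge0 => i _; rewrite mulr_ge0// exprn_ge0.
- by move=> x ax; rewrite Phi_step ramp1// f_mono.
- move=> x /andP[ax xfa]; rewrite -{1}(finvK x) Phi_step finvK Phi0 ?mulr0 ?addr0.
    by rewrite rampE// ax.
  by rewrite -f_mono finvK.
Unshelve. all: by end_near. Qed.

End wandering_homeomorphism.

(** * Bounding dynamical distances *)

Section dynamical_distance.
Variables (R : realType) (X : metricType R) (g : X -> X).

Lemma dyn_dist_lt n eps x y : 0 < eps ->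
  (forall i, (i < n)%N -> mdist (iter i g x) (iter i g y) < eps) ->
  dyn_dist g n x y < eps.
Proof. by move=> eps0 gP; apply: bigmax_lt => // i _; exact: gP. Qed.

Lemma mdist_le_dyn_dist n i x y : (i < n)%N ->
  mdist (iter i g x) (iter i g y) <= dyn_dist g n x y.
Proof.
move=> ni.
exact: (@le_bigmax _ _ _ 0 (fun i : 'I_n => mdist (iter i g x) (iter i g y)) (Ordinal ni)).
Qed.

Lemma dyn_distxx n x : dyn_dist g n x x = 0.
Proof. by apply: bigmax_eq_id => i _; rewrite mdistxx. Qed.

End dynamical_distance.

(** * The metric of the height modulo 1 *)

Section height_metric.
Variable R : realType.
Local Notation I := (open_unit_interval R).
Variables f finv : I -> I.
Hypotheses (fK : cancel f finv) (finvK : cancel finv f).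
Hypotheses (f_cont : continuous f) (finv_cont : continuous finv).
Hypothesis f_gt : forall x : I, \val x < \val (f x).
Variables (N : nat) (a : I) (Phi : I -> R).
Hypotheses (N_gt0 : (0 < N)%N) (Phi_cont : continuous Phi).
Hypotheses (Phi_ge0 : forall x, 0 <= Phi x).
Hypotheses (Phi_eq0 : forall x, \val x <= \val a -> Phi x = 0).
Hypothesis PhiS : forall x, \val a <= \val x -> Phi (f x) = 1 + N%:R * Phi x.
Hypothesis PhiE : forall x, \val a <= \val x <= \val (f a) ->
  Phi x = (\val x - \val a) / (\val (f a) - \val a).
Implicit Types x y : I.

Let NR_ge1 : 1 <= N%:R :> R. Proof. by rewrite ler1n. Qed.
Let NX_ge1 n : 1 <= N%:R ^+ n :> R. Proof. exact: exprn_ege1. Qed.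

(** The recursion for the height can be inverted on the whole interval, not
    only above a, since Phi (f x) <= 1 for x <= a. *)
Lemma Phi_eq_max x : Phi x = Num.max 0 ((Phi (f x) - 1) / N%:R).
Proof.
have N0 : 0 < N%:R :> R by rewrite ltr0n.
have [xa|ax] := leP (\val x) (\val a); last first.
  rewrite PhiS ?ltW// addrAC subrr add0r mulrC mulKf ?gt_eqF//.
  by rewrite (max_idPr _).
rewrite Phi_eq0// (max_idPl _)// pmulr_lle0 ?invr_gt0// subr_le0.
have [fxa|afx] := leP (\val (f x)) (\val a); first by rewrite Phi_eq0.
have fx_le : \val (f x) <= \val (f a) by rewrite (f_mono fK f_cont f_gt).
rewrite PhiE ?(ltW afx)// ler_pdivrMr ?subr_gt0// mul1r.
by rewrite lerD2r.
Qed.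

(** The map t |-> max 0 ((t - 1) / N), which takes Phi (f x) to Phi x, is
    (1 / N)-Lipschitz. *)
Lemma Phi_contract x y : `|Phi x - Phi y| <= `|Phi (f x) - Phi (f y)|.
Proof.
have N0 : 0 < N%:R :> R by rewrite ltr0n.
have max_lip (s t : R) : `|Num.max 0 s - Num.max 0 t| <= `|s - t|.
  rewrite !maxEle; case: (leP 0 s) => s0; case: (leP 0 t) => t0;
  by rewrite ler_norml; have := ler_norm (s - t); have := ler_norm (t - s); rewrite (distrC t); lra.
rewrite (Phi_eq_max x) (Phi_eq_max y); apply: le_trans (max_lip _ _) _.
rewrite -mulrBl opprB addrA subrK normrM.
rewrite [`|_^-1|]ger0_norm ?invr_ge0// ler_pdivrMr//.
by rewrite ler_peMr.
Qed.

Lemma Phi_contract_iter_f i n x y : (i <= n)%N ->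
  `|Phi (iter i f x) - Phi (iter i f y)| <= `|Phi (iter n f x) - Phi (iter n f y)|.
Proof.
move=> /subnK <-; elim: (n - i)%N => [|k IH]; first exact: lexx.
by apply: le_trans IH _; rewrite addSn; exact: Phi_contract.
Qed.

Lemma Phi_contract_iter_finv i x y :
  `|Phi (iter i finv x) - Phi (iter i finv y)| <= `|Phi x - Phi y|.
Proof.
elim: i => [//|i IH]; apply: le_trans IH.
by have := Phi_contract (iter i.+1 finv x) (iter i.+1 finv y); rewrite /= !finvK.
Qed.

Lemma iter_f_above i x : \val a <= \val x -> \val a <= \val (iter i f x).
Proof. by move=> ax; apply: le_trans ax _; exact: (iter_f_le f_gt x (leq0n i)). Qed.

Lemma Phi_iter_sub i x y : \val a <= \val x -> \val a <= \val y ->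
  Phi (iter i f x) - Phi (iter i f y) = N%:R ^+ i * (Phi x - Phi y).
Proof.
move=> ax ay; elim: i => [|i IH]; first by rewrite expr0 mul1r.
rewrite !iterS !PhiS ?iter_f_above// exprS -mulrA -IH; ring.
Qed.

Lemma Phi_iter_le n x : \val x <= \val a -> Phi (iter n f x) <= n%:R * N%:R ^+ n.
Proof.
move=> xa; elim: n => [|n IH]; first by rewrite Phi_eq0// mul0r.
have step y : Phi (f y) <= 1 + N%:R * Phi y.
  have N0 : 0 < N%:R :> R by rewrite ltr0n.
  rewrite (Phi_eq_max y) -lerBlDl -ler_pdivrMl// mulrC.
  by rewrite le_max lexx orbT.
apply: le_trans (step _) _; rewrite -natr1 exprS mulrDl mul1r addrC.
apply: lerD; last by rewrite -exprS.
by rewrite mulrCA ler_pM2l// ltr0n.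
Qed.

Definition hdist x y : R := `|\val x - \val y| + dist_int (Phi x - Phi y).

Lemma hdist_is_metric : is_metric hdist.
Proof.
split=> [x|x y|x y|y x z]; rewrite /hdist.
- by rewrite !subrr normr0 dist_int0 addr0.
- move=> /eqP; rewrite paddr_eq0 ?dist_int_ge0// normr_eq0 subr_eq0.
  by move=> /andP[/eqP/val_inj].
- by rewrite distrC -dist_intN opprB.
- rewrite addrACA; apply: lerD; first exact: ler_distD.
  have -> : Phi x - Phi z = (Phi x - Phi y) + (Phi y - Phi z) by rewrite addrA subrK.
  exact: dist_intD.
Qed.

Let X : metricType R := metric_space hdist_is_metric.

Lemma hdist_lt x y eps : `|\val x - \val y| < eps / 2 ->
  dist_int (Phi x - Phi y) < eps / 2 -> hdist x y < eps.
Proof. by move=> ? ?; rewrite [ltRHS]splitr ltrD. Qed.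

(** One direction is the continuity of Phi, the other the inequality
    |x - y| <= hdist x y. *)
Lemma hdist_open (A : set I) : @open X A <-> open A.
Proof.
rewrite !openE; split=> oA x Ax; have := oA x Ax; rewrite /interior.
  move=> /nbhs_ballP[e /= e0 eA].
  have hc : \forall y \near x, hdist x y < e.
    near=> y; apply: hdist_lt; last first.
      apply: le_lt_trans (dist_int_le_norm _) _.
      near: y. apply: cvgr_dist_lt; [exact: Phi_cont|exact: divr_gt0].
    near: y; apply: cvgr_dist_lt; [exact: continuous_val_oui|exact: divr_gt0].
  by apply: filterS hc => y xy; apply: eA; rewrite ballEmdist.
move=> /nbhs_ouiP[e e0 eA]; apply/nbhs_ballP; exists e => //= y.
rewrite ballEmdist /= => xy; apply: eA; apply: le_lt_trans xy.
by rewrite /mdist/= lerDl dist_int_ge0.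
Unshelve. all: by end_near. Qed.

(** * Coding orbit segments *)

Lemma orbit_code_f eps : 0 < eps -> exists m : nat, forall n,
  exists code : I -> {ffun 'I_m -> 'I_n.+1}, forall x y, code x = code y ->
    forall i, (i < n)%N -> `|\val (iter i f x) - \val (iter i f y)| < eps.
Proof.
move=> eps0; apply: (monotone_code (u := fun i x => \val (iter i f x))) => //.
  by move=> i x; rewrite !ltW// ?val_oui_gt0// val_oui_lt1.
by move=> i j x; exact: iter_f_le.
Qed.

Lemma orbit_code_finv eps : 0 < eps -> exists m : nat, forall n,
  exists code : I -> {ffun 'I_m -> 'I_n.+1}, forall x y, code x = code y ->
    forall i, (i < n)%N -> `|\val (iter i finv x) - \val (iter i finv y)| < eps.
Proof.
move=> eps0.
have [||m mP] := monotone_code (u := fun i x => 1 - \val (iter i finv x)) eps0.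
- by move=> i x; rewrite subr_ge0 gerBl !ltW// ?val_oui_gt0// val_oui_lt1.
- by move=> i j x ij; rewrite lerD2l lerN2; exact: (iter_finv_le fK finvK f_cont f_gt).
exists m => n; have [code codeP] := mP n; exists code => x y xy i ni.
by rewrite distrC; have := codeP x y xy i ni; congr (`|_| < _); ring.
Qed.

Let truncn_bound (B : R) : 0 <= B -> (Num.truncn B).+1%:R <= B + 1.
Proof. by move=> B0; rewrite -natr1 lerD2r truncn_le. Qed.

(** The code of x records on which side of a it lies, and one real number
    between 0 and n.+1 * N^n up to eps / 2: left of a the height after n
    steps, right of a the fractional part of the height scaled by N^n.  The
    exponent m.+1 absorbs the factor n.+1 of this range. *)
Lemma forward_code eps : 0 < eps -> exists (A : R) (m : nat), 0 < A /\
  forall n, exists (C : finType) (code : I -> C),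
    #|C|%:R <= A * n.+1%:R ^+ m * N%:R ^+ n /\
    forall x y, code x = code y ->
      forall i, (i < n)%N -> hdist (iter i f x) (iter i f y) < eps.
Proof.
move=> eps0; have eps2 : 0 < eps / 2 by exact: divr_gt0.
have [m mP] := orbit_code_f eps2.
exists (2 * ((eps / 2)^-1 + 1)), m.+1; split.
  by rewrite mulr_gt0// ltr_wpDl// invr_ge0 ltW.
move=> n; have [pcode pcodeP] := mP n.
have NX_gt0 : 0 < N%:R ^+ n :> R := lt_le_trans ltr01 (NX_ge1 n).
pose v x : R := if \val x <= \val a then Phi (iter n f x)
  else (Phi x - (Num.floor (Phi x))%:~R) * N%:R ^+ n.
pose B : R := n.+1%:R * N%:R ^+ n.
have B_ge0 : 0 <= B by rewrite mulr_ge0// ltW.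
have vB x : 0 <= v x <= B.
  rewrite /v; case: ifP => xa.
    rewrite Phi_ge0 (le_trans (Phi_iter_le n xa))// ler_pM2r//.
    by rewrite ler_nat.
  have /andP[fl_le fl_gt] := floor_itv (Phi x); rewrite intrD in fl_gt.
  rewrite mulr_ge0 ?subr_ge0 ?(ltW NX_gt0)//=.
  rewrite ler_pM2r// (@le_trans _ _ 1) ?ler1n// lerBlDr addrC ltW//.
have [gcode gcodeP] := grid_code eps2 vB.
exists ({ffun 'I_m -> 'I_n.+1} * bool * 'I_(Num.truncn (B / (eps / 2))).+1)%type.
exists (fun x => (pcode x, \val x <= \val a, gcode x)); split.
  rewrite !card_prod card_ffun !card_ord card_bool !natrM natrX.
  have -> : 2 * ((eps / 2)^-1 + 1) * n.+1%:R ^+ m.+1 * N%:R ^+ n =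
     n.+1%:R ^+ m * 2 * (B / (eps / 2) + B) :> R by rewrite exprS /B; ring.
  rewrite ler_wpM2l ?mulr_ge0 ?exprn_ge0//.
  apply: le_trans (truncn_bound _) _; first by rewrite divr_ge0// ltW.
  by rewrite lerD2l -[leLHS]mul1r ler_pM// ler1n.
move=> x y [] pxy axy /gcodeP vxy i ni; apply: hdist_lt; first exact: pcodeP.
move: vxy; rewrite /v -axy; case: ifP => xa vxy.
  apply: le_lt_trans (dist_int_le_norm _) _; apply: le_lt_trans vxy.
  exact/Phi_contract_iter_f/ltnW.
have ax z : (\val z <= \val a) = false -> \val a <= \val z by move=> /negbT; rewrite -ltNge => /ltW.
rewrite Phi_iter_sub; [|exact: ax|by apply: ax; rewrite -axy].
rewrite -natrX; apply: le_lt_trans (dist_intMn _ _) _; rewrite natrX.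
apply: le_lt_trans vxy; rewrite -mulrBl normrM [X in _ <= _ * X]ger0_norm ?(ltW NX_gt0)// mulrC.
apply: (@le_trans _ _ (dist_int (Phi x - Phi y) * N%:R ^+ n)).
  by rewrite ler_wpM2l ?dist_int_ge0// ler_weXn2l// ltnW.
rewrite ler_pM2r//.
have := dist_int_le (Phi x - Phi y) (Num.floor (Phi x) - Num.floor (Phi y)).
by congr (_ <= `|_|); rewrite intrD mulrNz; ring.
Qed.

(** Heights are contracted along backward orbits, so that the initial height,
    to within eps / 2, controls them at all times: only the factor n.+1 ^+ m
    for the positions grows with n. *)
Lemma backward_code (K : set I) B eps : 0 < eps -> 0 <= B ->
    (forall x, K x -> Phi x <= B) ->
  exists (A : R) (m : nat), 0 < A /\
  forall n, exists (C : finType) (code : I -> C),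
    #|C|%:R <= A * n.+1%:R ^+ m /\
    forall x y, K x -> K y -> code x = code y ->
      forall i, (i < n)%N -> hdist (iter i finv x) (iter i finv y) < eps.
Proof.
move=> eps0 B0 PhiB; have eps2 : 0 < eps / 2 by exact: divr_gt0.
have [m mP] := orbit_code_finv eps2.
have vB x : 0 <= Num.min B (Phi x) <= B by rewrite le_min B0 Phi_ge0 ge_min lexx.
have [gcode gcodeP] := grid_code eps2 vB.
exists (Num.truncn (B / (eps / 2))).+1%:R, m; split=> // n.
have [pcode pcodeP] := mP n.
exists ({ffun 'I_m -> 'I_n.+1} * 'I_(Num.truncn (B / (eps / 2))).+1)%type.
exists (fun x => (pcode x, gcode x)); split.
  by rewrite !card_prod card_ffun !card_ord natrM natrX mulrC.
move=> x y Kx Ky [] pxy /gcodeP vxy i ni; apply: hdist_lt; first exact: pcodeP.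
apply: le_lt_trans (dist_int_le_norm _) _.
apply: le_lt_trans (Phi_contract_iter_finv _ _ _) _.
by move: vxy; rewrite !min_r// PhiB.
Qed.

(** Let k be maximal such that N^k divides q - q'.  Multiplication by N^(n-k-1)
    turns (q - q') / N^n into a fraction with denominator N whose numerator is
    not divisible by N. *)
Lemma orbits_separate n (q q' : nat) x y : (q < N ^ n)%N -> (q' < N ^ n)%N -> q <> q' ->
  \val a <= \val x -> \val a <= \val y ->
  Phi x = q%:R / N%:R ^+ n -> Phi y = q'%:R / N%:R ^+ n ->
  exists2 i, (i < n)%N & N%:R^-1 <= hdist (iter i f x) (iter i f y).
Proof.
move=> qn q'n qq' ax ay Phix Phiy.
pose D : int := (q%:Z - q'%:Z)%R.
have ND : ~~ (((N ^ n)%N : int) %| D)%Z.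
  rewrite dvdzE/= gtnNdvd//; last by rewrite /D; lia.
  by rewrite absz_gt0 subr_eq0; apply/eqP => -[].
have [k kP kmin] := ex_minnP (ex_intro (fun k => ~~ (((N ^ k)%N : int) %| D)%Z) n ND).
have kn : (k <= n)%N by exact: kmin.
case: k kP kmin kn => [|k] kP kmin kn; first by rewrite expn0 dvd1z in kP.
have /dvdzP[c Dc] : (((N ^ k)%N : int) %| D)%Z.
  by apply/negPn/negP => /kmin; rewrite ltnn.
exists (n - k.+1)%N; first by rewrite ltn_subrL (leq_trans _ kn).
apply: (@le_trans _ _ (dist_int (c%:~R / N%:R))).
  apply: dist_int_frac => //; apply: contra kP => /dvdzP[c' cc'].
  by rewrite Dc cc' -mulrA -PoszM -expnS dvdz_mull.
rewrite /hdist Phi_iter_sub// Phix Phiy -mulrBl.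
have N0 : N%:R != 0 :> R by rewrite pnatr_eq0 -lt0n.
have -> : q%:R - q'%:R = c%:~R * N%:R ^+ k :> R.
  by rewrite -natrX !pmulrn -intrM -Dc intrD mulrNz.
have -> : N%:R ^+ n = N%:R ^+ (n - k.+1) * N%:R ^+ k * N%:R :> R.
  by rewrite -mulrA -exprSr -exprD subnK.
rewrite [X in _ <= _ + dist_int X](_ : _ = c%:~R / N%:R) ?lerDr//.
by field; rewrite ?N0 ?expf_neq0.
Qed.
(** * The entropies *)

Lemma maxsep_le_codes (g : I -> I) (K : set I) eps (C : finType) (code : I -> C) n (M : R) :
  0 < eps -> #|C|%:R <= M ->
  (forall x y, K x -> K y -> code x = code y ->
     forall i, (i < n)%N -> hdist (iter i g x) (iter i g y) < eps) ->
  (@maxsep R X K (@dyn_dist R X g n) eps <= M%:E)%E.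
Proof.
move=> eps0 CM codeP.
apply: (@le_trans _ _ (#|C|%:R : R)%:E); last by rewrite lee_fin.
apply: (@maxsep_le_card R X _ code) => x y Kx Ky xy.
by apply: dyn_dist_lt => // i ni; exact: codeP.
Qed.

Lemma hBD_f_le (K : set I) : (hBD X f K <= (ln N%:R)%:E)%E.
Proof.
apply: hBD_le_ln => // eps eps0; have [A [m [A0 mP]]] := forward_code eps0.
exists A, m; split=> // n; have [C [code [CM codeP]]] := mP n.
by apply: (@maxsep_le_codes _ _ _ _ code) => // x y _ _; exact: codeP.
Qed.

Lemma iter_finv_f i n x : (i <= n)%N -> iter i finv x = iter (n - i) f (iter n finv x).
Proof.
move=> /subnKC {2}<-; rewrite addnC iterD.
by elim: (n - i)%N (iter i finv x) => //= k IH z; rewrite -iterS iterSr finvK.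
Qed.

(** The first n iterates of x under f^-1 are the first n iterates of
    f^-(n-1) x under f in reverse order: code x by the forward code of that
    point. *)
Lemma hBD_finv_le : (hBD X finv [set: I] <= (ln N%:R)%:E)%E.
Proof.
apply: hBD_le_ln => // eps eps0; have [A [m [A0 mP]]] := forward_code eps0.
exists A, m; split=> // n; have [C [code [CM codeP]]] := mP n.
apply: (@maxsep_le_codes _ _ _ _ (code \o iter n.-1 finv)) => // x y _ _ /= /codeP xy i ni.
have i_le : (i <= n.-1)%N by rewrite -ltnS prednK// (leq_ltn_trans _ ni).
rewrite !(iter_finv_f _ i_le); apply: xy; apply: leq_ltn_trans (leq_subr _ _) _.
by rewrite prednK// (leq_ltn_trans _ ni).
Qed.

Lemma compact_transfer (K : set I) : @compact X K <-> compact K.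
Proof.
have toX : continuous (fun x : I => x : X).
  by apply/continuousP => A /hdist_open.
have ofX : continuous (fun x : X => x : I).
  by apply/continuousP => A /hdist_open.
split=> [Kc|Kc].
  rewrite -(image_id K); apply: (@continuous_compact X I id) => //.
  exact/continuous_subspaceT.
rewrite -(image_id K); apply: (@continuous_compact I X id) => //.
exact/continuous_subspaceT.
Qed.

Lemma hBD_finv_compact_le (K : set I) : @compact X K -> (hBD X finv K <= 0)%E.
Proof.
move=> /compact_transfer Kc.
have [B B0 PhiB] : exists2 B, 0 <= B & forall x, K x -> Phi x <= B.
  have PhiK : compact (Phi @` K).
    by apply: continuous_compact => //; exact: continuous_subspaceT.
  have [M [_ MP]] := compact_bounded PhiK.
  exists (`|M| + 1) => [|x Kx]; first by rewrite addr_ge0.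
  apply: le_trans (ler_norm _) _; apply: (MP (`|M| + 1)); last by exists x.
  by rewrite ltr_pwDr// ler_norm.
rewrite (_ : 0%E = (ln 1%:R)%:E :> \bar R); last by rewrite ln1.
apply: hBD_le_ln => // eps eps0.
have [A [m [A0 mP]]] := backward_code eps0 B0 PhiB.
exists A, m; split=> // n; have [C [code [CM codeP]]] := mP n.
apply: (@maxsep_le_codes _ _ _ _ code) => //.
by rewrite expr1n mulr1.
Qed.

(** The fundamental domain from a to f a carries all of the entropy of f. *)
Let K0 : set I := [set x : I | \val a <= \val x <= \val (f a)].

Lemma exists_grid n : exists h : nat -> I, forall q, (q < N ^ n)%N ->
  K0 (h q) /\ Phi (h q) = q%:R / N%:R ^+ n.
Proof.
have len_gt0 : 0 < \val (f a) - \val a by rewrite subr_gt0.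
pose r q : R := \val a + (q%:R / N%:R ^+ n) * (\val (f a) - \val a).
exists (fun q => oui (r q)) => q qn.
have q_itv : 0 <= q%:R / (N%:R : R) ^+ n <= 1.
  rewrite divr_ge0 ?exprn_ge0// ler_pdivrMr ?exprn_gt0 ?ltr0n//.
  by rewrite mul1r -natrX ler_nat ltnW.
have /andP[q0 q1] := q_itv.
have ar : \val a <= r q by rewrite lerDl mulr_ge0// ltW.
have rfa : r q <= \val (f a) by rewrite -lerBrDl ler_piMl// ltW.
have rE : \val (oui (r q)) = r q.
  apply: ouiK; first exact: lt_le_trans (val_oui_gt0 a) ar.
  exact: le_lt_trans rfa (val_oui_lt1 _).
have Kr : K0 (oui (r q)) by rewrite /K0 /= rE ar.
split=> //; rewrite PhiE// rE /r addrAC subrr add0r mulfK// gt_eqF//.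
Qed.

Lemma ln_le_hBD_f : ((ln N%:R)%:E <= hBD X f K0)%E.
Proof.
apply: (@ln_le_hBD _ _ _ _ _ N%:R^-1) => //; first by rewrite invr_gt0 ltr0n.
move=> eps n eps0 epsN; have [h hP] := exists_grid n.
rewrite -natrX; apply: (@le_maxsep R X _ h) => //; first exact: dyn_distxx.
  by move=> q /hP[].
move=> q q' qn q'n qq'; have [Kq Phiq] := hP q qn; have [Kq' Phiq'] := hP q' q'n.
have /andP[aq _] := Kq; have /andP[aq' _] := Kq'.
have [i ni iP] := orbits_separate qn q'n qq' aq aq' Phiq Phiq'.
apply: le_trans epsN _; apply: le_trans iP _.
exact: (@mdist_le_dyn_dist R X).
Qed.

(** The points that f separates, moved forward n - 1 steps. *)
Lemma ln_le_hBD_finv : ((ln N%:R)%:E <= hBD X finv [set: I])%E.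
Proof.
apply: (@ln_le_hBD _ _ _ _ _ N%:R^-1) => //; first by rewrite invr_gt0 ltr0n.
move=> eps n eps0 epsN; have [h hP] := exists_grid n.
rewrite -natrX; apply: (@le_maxsep R X _ (iter n.-1 f \o h)) => //; first exact: dyn_distxx.
move=> q q' qn q'n qq'; have [Kq Phiq] := hP q qn; have [Kq' Phiq'] := hP q' q'n.
have /andP[aq _] := Kq; have /andP[aq' _] := Kq'.
have [i ni iP] := orbits_separate qn q'n qq' aq aq' Phiq Phiq'.
apply: le_trans epsN _; apply: le_trans iP _.
have n0 : (0 < n)%N by rewrite (leq_ltn_trans _ ni).
have i_le : (i <= n.-1)%N by rewrite -ltnS prednK.
have back z : iter i f z = iter (n.-1 - i) finv (iter n.-1 f z).
  rewrite -{2}(subnK i_le) iterD.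
  by elim: (n.-1 - i)%N (iter i f z) => //= k IH w; rewrite -iterS iterSr fK.
rewrite !back; apply: (@mdist_le_dyn_dist R X).
by apply: leq_ltn_trans (leq_subr _ _) _; rewrite prednK.
Qed.

(** Picking one point for each forward code of length 1 gives an eps-net. *)
Lemma hdist_totally_bounded : totally_bounded X.
Proof.
move=> eps eps0; have [A [m [A0 /(_ 1%N)]]] := forward_code eps0.
move=> [C [code [_ codeP]]].
have [rep repP] : exists rep : C -> I, forall x, code (rep (code x)) = code x.
  have /choice[rep repP] : forall c, exists z, (exists x, code x = c) -> code z = c.
    move=> c; have [[x xc]|no] := pselect (exists x, code x = c).
      by exists x.
    by exists a => /no.
  by exists rep => x; apply: repP; exists x.
exists (range rep); first exact: finite_image.
apply/seteqP; split=> [x _|//]; exists (rep (code x)); first by exists (code x).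
by rewrite ballEmdist /=; apply: (codeP _ _ (repP x) 0%N).
Qed.

Lemma height_metric_entropies : [/\ totally_bounded X,
   (forall A : set I, @open X A <-> open A),
        hBD X f [set: X] = (ln (N%:R : R))%:E /\
        hBD X finv [set: X] = (ln (N%:R : R))%:E,
        hBc X f = (ln (N%:R : R))%:E &
        hBc X finv = 0%E].
Proof.
have K0c : @compact X K0 by apply/compact_transfer; exact: compact_oui_itv.
split; [exact: hdist_totally_bounded|exact: hdist_open|split|..];
  apply/eqP; rewrite eq_le; apply/andP; split.
- exact: hBD_f_le.
- exact: le_trans ln_le_hBD_f (hBD_subset _ _).
- exact: hBD_finv_le.
- exact: ln_le_hBD_finv.
- by apply: ge_ereal_sup => _ [K _ <-]; exact: hBD_f_le.
- by apply: le_trans ln_le_hBD_f _; apply: ereal_sup_ubound; exists K0.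
- by apply: ge_ereal_sup => _ [K Kc <-]; exact: hBD_finv_compact_le.
- apply: (@le_trans _ _ (hBD X finv K0)); last by apply: ereal_sup_ubound; exists K0.
  rewrite (_ : 0%E = (ln 1%:R)%:E :> \bar R); last by rewrite ln1.
  apply: (@ln_le_hBD _ _ _ _ _ 1) => // eps n eps0 _.
  rewrite expr1n; apply: (@le_maxsep R X 1 (fun=> a)) => //; first exact: dyn_distxx.
    by move=> _ _; rewrite /K0/= lexx ltW// f_gt.
  by move=> [|i] [|j].
Qed.

End height_metric.

Theorem proposition8 (R : realType)
    (f finv : open_unit_interval R -> open_unit_interval R)
    (fK : cancel f finv) (finvK : cancel finv f)
    (f_cont : continuous f) (finv_cont : continuous finv)
    (f_gt : forall x : open_unit_interval R, \val x < \val (f x))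
    (N : nat) (N_gt0 : (0 < N)%N) :
  exists (d : open_unit_interval R -> open_unit_interval R -> R)
         (dm : is_metric d),
    let X : metricType R := metric_space dm in
    [/\ totally_bounded X,
        (forall A : set (open_unit_interval R), @open X A <-> open A),
        hBD X f [set: X] = (ln (N%:R : R))%:E /\
        hBD X finv [set: X] = (ln (N%:R : R))%:E,
        hBc X f = (ln (N%:R : R))%:E &
        hBc X finv = 0%E].
Proof.
have [Phi [Phi_cont Phi_ge0 Phi_eq0 PhiS PhiE]] :=
  exists_height fK finvK f_cont finv_cont f_gt (oui_half R) N.
exists (hdist Phi), (hdist_is_metric Phi).
exact: (height_metric_entropies fK finvK f_cont f_gt N_gt0 Phi_cont Phi_ge0 Phi_eq0 PhiS PhiE).
Qed.
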